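(* Let $(p_n)_{n\ge1}$ and $(q_n)_{n\ge1}$ be real sequences with $0<q_n<p_n\le 1$ for all $n$ and $\lim_{n\to\infty}p_n=1$, $\lim_{n\to\infty}q_n=1$. Let $0<\alpha\le1$, $M>0$, and let $E\subset\mathbb{R}_+$ be nonempty. Then for all $f\in\widetilde{W}_{\alpha,E}$ (the Lipschitz-type class with constant $M$), all $n\ge1$ and all $x\ge0$, $$\left|L_n^{p_n,q_n}(f;x)-f(x)\right|\le M\left(\delta_n^{\frac{\alpha}{2}}(x)+2\,(d(x,E))^{\alpha}\right),$$ where $$\delta_n(x)=\frac{x^2}{(1+x)^2}\left(\frac{p_nq_n^2[n]_{p_n,q_n}[n-1]_{p_n,q_n}}{[n+1]_{p_n,q_n}^2}\,\frac{1+x}{p_n+q_nx}-2\,\frac{p_n[n]_{p_n,q_n}}{[n+1]_{p_n,q_n}}+1\right)+\frac{p_n^{n+1}[n]_{p_n,q_n}}{[n+1]_{p_n,q_n}^2}\,\frac{x}{1+x}.$$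
   Context: $\mathbb{R}_+=[0,\infty)$. For $E\subset\mathbb{R}_+$, $d(x,E)=\inf\{|x-y|:y\in E\}$. For $0<\alpha\le 1$, a positive constant $M$ and $E\subset\mathbb{R}_+$, the Lipschitz-type maximal function class $\widetilde{W}_{\alpha,E}$ consists of all bounded continuous functions $f:\mathbb{R}_+\to\mathbb{R}$ such that $$(1+x)^\alpha\,\frac{|f(x)-f(y)|}{|x-y|^\alpha}\le\frac{M}{(1+y)^\alpha}\qquad\text{for all }x\ge0,\ y\in E,\ x\ne y.$$ For $0<q<p\le1$ and integers $n\ge 0$, the $(p,q)$-integers are $[n]_{p,q}=\frac{p^n-q^n}{p-q}$; $[n]_{p,q}!=[1]_{p,q}[2]_{p,q}\cdots[n]_{p,q}$ with $[0]_{p,q}!=1$; $\binom{n}{k}_{p,q}=\frac{[n]_{p,q}!}{[k]_{p,q}!\,[n-k]_{p,q}!}$ for $0\le k\le n$. For $n\ge1$, $x\ge 0$ and $f:\mathbb{R}_+\to\mathbb{R}$, the $(p,q)$-Bleimann–Butzer–Hahn operator is $$L_n^{p,q}(f;x)=\frac{1}{\ell_n^{p,q}(x)}\sum_{k=0}^n f\left(\frac{p^{n-k+1}[k]_{p,q}}{[n-k+1]_{p,q}\,q^k}\right)p^{\frac{(n-k)(n-k-1)}{2}}q^{\frac{k(k-1)}{2}}\binom{n}{k}_{p,q}x^k,\qquad \ell_n^{p,q}(x)=\prod_{s=0}^{n-1}(p^s+q^sx).$$ *)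

(* Defs.v *)
From HB Require Import structures.
From mathcomp Require Import all_boot all_order all_algebra.
From mathcomp Require Import all_classical all_reals all_analysis.

Set Implicit Arguments.
Unset Strict Implicit.
Unset Printing Implicit Defensive.

Import Order.TTheory GRing.Theory Num.Theory.
Import numFieldNormedType.Exports.

Local Open Scope classical_set_scope.
Local Open Scope ring_scope.

(* A function on R_+ = [0, +oo[ is represented by a total f : R -> R, of which
   only the values on [0, +oo[ are ever used. *)

(* The infimum is the real one: it is a distance only when E is nonempty
   (inf set0 = 0). *)
Definition dist_set (R : realType) (x : R) (E : set R) : R :=
  inf [set `|x - y| | y in E].

Definition lip_max_class (R : realType) (alpha M : R) (E : set R) :
    set (R -> R) :=
  [set f : R -> R | [/\ [bounded f x | x in `[0, +oo[],
               {within `[0, +oo[, continuous f}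
             & forall x y : R, 0 <= x -> E y -> x != y ->
                 (1 + x) `^ alpha * (`|f x - f y| / `|x - y| `^ alpha)
                   <= M / (1 + y) `^ alpha]].

Definition pq_int (R : realType) (p q : R) (n : nat) : R :=
  (p ^+ n - q ^+ n) / (p - q).

Definition pq_fact (R : realType) (p q : R) (n : nat) : R :=
  \prod_(1 <= i < n.+1) pq_int p q i.

Definition pq_binom (R : realType) (p q : R) (n k : nat) : R :=
  pq_fact p q n / (pq_fact p q k * pq_fact p q (n - k)).

Definition bbh_ell (R : realType) (n : nat) (p q x : R) : R :=
  \prod_(0 <= s < n) (p ^+ s + q ^+ s * x).

(* For k = n the exponent (n - k) * (n - k - 1) / 2 is 0, also with the
   truncated predecessor; likewise k * (k - 1) / 2 for k = 0. *)
Definition bbh_op (R : realType) (n : nat) (p q : R) (f : R -> R) (x : R) : R :=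
  (bbh_ell n p q x)^-1 *
  \sum_(0 <= k < n.+1)
    f (p ^+ (n - k + 1) * pq_int p q k / (pq_int p q (n - k + 1) * q ^+ k)) *
    p ^+ (((n - k) * (n - k).-1) %/ 2) * q ^+ ((k * k.-1) %/ 2) *
    pq_binom p q n k * x ^+ k.

Definition bbh_delta (R : realType) (n : nat) (p q x : R) : R :=
  x ^+ 2 / (1 + x) ^+ 2 *
    (p * q ^+ 2 * pq_int p q n * pq_int p q (n - 1) / pq_int p q (n + 1) ^+ 2
       * ((1 + x) / (p + q * x))
     - 2 * (p * pq_int p q n / pq_int p q (n + 1)) + 1)
  + p ^+ (n + 1) * pq_int p q n / pq_int p q (n + 1) ^+ 2 * (x / (1 + x)).

(* Main.v *)
Require Import Defs.
From HB Require Import structures.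
From mathcomp Require Import all_boot all_order all_algebra.
From mathcomp Require Import all_classical all_reals all_analysis.
From mathcomp Require Import ring lra.

Set Implicit Arguments.
Unset Strict Implicit.
Unset Printing Implicit Defensive.

Import Order.TTheory GRing.Theory Num.Theory.
Import numFieldNormedType.Exports.

Local Open Scope classical_set_scope.
Local Open Scope ring_scope.

(** The change of variable [tau t = t / (1 + t)] explains everything.  Since
    [tau s - tau t = (s - t) / ((1 + s) (1 + t))], the defining inequality of
    the class reads [|f x - f y| <= M |tau x - tau y| ^ alpha] for [y] in [E]
    ([lip_max_class_tau]), and [tau] does not increase distances.  Going from a
    node [t] to [x] through [y], and using that [u |-> u ^ alpha] is
    subadditive, gives ([lip_max_class_split])
    [|f t - f x| <= M (|tau t - tau x| ^ alpha + 2 |x - y| ^ alpha)].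

    The operator is an average with nonnegative weights of total mass 1, by
    the (p,q)-binomial theorem.  Averaging the inequality above and applying
    Jensen's inequality to the concave function [u |-> u ^ (alpha / 2)] leaves
    the [alpha / 2]-th power of the mean square deviation of [tau] from [tau x]
    ([bbh_op_error_le]).  As [y] in [E] is arbitrary, [|x - y|] can then be
    replaced by its infimum.

    That deviation is computed from the first two moments of [tau].  The nodes are
    chosen so that [tau] maps the [k]-th one to
    [p / [n + 1] * (p ^ (n - k) [k])] ([tau_bbh_node]), and multiplying a term
    of the (p,q)-binomial expansion by [p ^ (n - k) [k]] turns it into a term of
    the expansion of order [n - 1] at [(p a, q b)]
    ([pq_term_absorb_lower]).  The second moment so obtained has the
    coefficient [p ^ 2 q ^ 2] where [bbh_delta] has [p q ^ 2]; hence
    [bbh_delta] is only an upper bound of it, valid because [p <= 1]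
    ([bbh_tau_sqr_dev_le]). *)

(** * (p,q)-integers and (p,q)-binomial coefficients *)

Lemma pq_int0 (R : realType) (p q : R) : pq_int p q 0 = 0.
Proof. by rewrite /pq_int !expr0 subrr mul0r. Qed.

Lemma pq_int_gt0 (R : realType) (p q : R) n : 0 < q < p -> 0 < pq_int p q n.+1.
Proof.
move=> /andP[q0 qp]; rewrite divr_gt0// ?subr_gt0//.
by rewrite ltrXn2r// ?ltW// (lt_trans q0).
Qed.

Lemma pq_int_ge0 (R : realType) (p q : R) n : 0 < q < p -> 0 <= pq_int p q n.
Proof. by case: n => [|n] qp; rewrite ?pq_int0// ltW// pq_int_gt0. Qed.

Lemma pq_intS (R : realType) (p q : R) n : p != q ->
  pq_int p q n.+1 = p ^+ n + q * pq_int p q n.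
Proof.
move=> pq; have pq0 : p - q != 0 by rewrite subr_eq0.
by rewrite /pq_int !exprS; field.
Qed.

(** Telescoping: both products share the mixed power [p ^ (n - k) * q ^ k].
    This one identity yields the binomial theorem and the simple form of
    [tau] at the nodes. *)
Lemma pq_int_split (R : realType) (p q : R) n k : p != q -> (k <= n)%N ->
  pq_int p q n = p ^+ (n - k) * pq_int p q k + q ^+ k * pq_int p q (n - k).
Proof.
move=> pq /subnK => {1}<-; have pq0 : p - q != 0 by rewrite subr_eq0.
by rewrite /pq_int !exprD; field.
Qed.

Lemma pq_factS (R : realType) (p q : R) n :
  pq_fact p q n.+1 = pq_int p q n.+1 * pq_fact p q n.
Proof. by rewrite /pq_fact big_nat_recr//= mulrC. Qed.

Lemma pq_fact_gt0 (R : realType) (p q : R) n : 0 < q < p -> 0 < pq_fact p q n.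
Proof.
move=> qp; elim: n => [|n IH]; first by rewrite /pq_fact big_nil.
by rewrite pq_factS mulr_gt0// pq_int_gt0.
Qed.

Lemma pq_binom_absorb_lower (R : realType) (p q : R) n k : 0 < q < p ->
  pq_int p q k.+1 * pq_binom p q n.+1 k.+1 = pq_int p q n.+1 * pq_binom p q n k.
Proof.
move=> qp; rewrite /pq_binom subSS !pq_factS.
have h1 := lt0r_neq0 (pq_int_gt0 k qp); have h2 := lt0r_neq0 (pq_fact_gt0 k qp).
have h3 := lt0r_neq0 (pq_fact_gt0 (n - k) qp).
by field; rewrite h1 h2 h3.
Qed.

Lemma pq_binom_absorb_upper (R : realType) (p q : R) n k : 0 < q < p ->
  (k <= n)%N ->
  pq_int p q (n.+1 - k) * pq_binom p q n.+1 k =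
  pq_int p q n.+1 * pq_binom p q n k.
Proof.
move=> qp kn; rewrite /pq_binom subSn// !pq_factS.
have h1 := lt0r_neq0 (pq_int_gt0 (n - k) qp).
have h2 := lt0r_neq0 (pq_fact_gt0 k qp).
have h3 := lt0r_neq0 (pq_fact_gt0 (n - k) qp).
by field; rewrite h1 h2 h3.
Qed.

(** * The (p,q)-binomial theorem and its moments *)

(** The binomials ['C(m, 2)] are the triangular exponents [m (m - 1) / 2];
    in this form [binS] governs how they grow.  Keeping [a] and [b] free is
    essential: absorption replaces them by [p a] and [q b]. *)
Definition pq_term (R : realType) (p q a b : R) (n k : nat) : R :=
  p ^+ 'C(n - k, 2) * q ^+ 'C(k, 2) * pq_binom p q n k * a ^+ (n - k) * b ^+ k.

(** The (p,q)-analogue of [(a + b) ^ n]. *)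
Definition pq_pow (R : realType) (p q a b : R) (n : nat) : R :=
  \prod_(0 <= s < n) (p ^+ s * a + q ^+ s * b).

Lemma pq_powS (R : realType) (p q a b : R) n :
  pq_pow p q a b n.+1 = (a + b) * pq_pow p q (p * a) (q * b) n.
Proof.
rewrite /pq_pow big_nat_recl// !expr0 !mul1r; congr (_ * _).
by apply: eq_bigr => s _; rewrite !exprSr !mulrA.
Qed.

(** The two triangular exponents absorb the extra factors:
    passing to [(p a, q b)] contributes [p ^ (n - k) * q ^ k], which is the
    increment of ['C(k, 2)] together with the power of [p] on the left. *)
Lemma pq_term_absorb_lower (R : realType) (p q a b : R) n k : 0 < q < p ->
  p ^+ (n - k) * pq_int p q k.+1 * pq_term p q a b n.+1 k.+1 =
  pq_int p q n.+1 * b * pq_term p q (p * a) (q * b) n k.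
Proof.
move=> qp; rewrite /pq_term subSS binS bin1 exprD !exprMn exprS.
transitivity (p ^+ (n - k) * p ^+ 'C(n - k, 2) * q ^+ 'C(k, 2) * q ^+ k *
  a ^+ (n - k) * b ^+ k * b * (pq_int p q k.+1 * pq_binom p q n.+1 k.+1)).
  by ring.
by rewrite pq_binom_absorb_lower//; ring.
Qed.

Lemma pq_term_absorb_upper (R : realType) (p q a b : R) n k : 0 < q < p ->
  (k <= n)%N ->
  q ^+ k * pq_int p q (n.+1 - k) * pq_term p q a b n.+1 k =
  pq_int p q n.+1 * a * pq_term p q (p * a) (q * b) n k.
Proof.
move=> qp kn; have := pq_binom_absorb_upper qp kn.
rewrite /pq_term subSn// binS bin1 exprD !exprMn exprS => E.
transitivity (p ^+ (n - k) * p ^+ 'C(n - k, 2) * q ^+ 'C(k, 2) * q ^+ k *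
  a ^+ (n - k) * b ^+ k * a * (pq_int p q (n - k).+1 * pq_binom p q n.+1 k)).
  by ring.
by rewrite E; ring.
Qed.

(** Absorption under the sum sign, with an arbitrary factor [g] so that it can
    be used a second time for the second moment.  The term [k = 0] vanishes
    because [[0] = 0]. *)
Lemma sum_pq_term_lower (R : realType) (p q a b : R) n (g : nat -> R) :
  0 < q < p ->
  \sum_(0 <= k < n.+2)
    g k * (p ^+ (n.+1 - k) * pq_int p q k * pq_term p q a b n.+1 k) =
  pq_int p q n.+1 * b *
    \sum_(0 <= k < n.+1) g k.+1 * pq_term p q (p * a) (q * b) n k.
Proof.
move=> qp; rewrite big_nat_recl// pq_int0 mulr0 mul0r mulr0 add0r mulr_sumr.
by apply: eq_bigr => k _; rewrite subSS pq_term_absorb_lower// mulrCA.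
Qed.

(** Pascal's rule is avoided: split [[n + 1] = p ^ (n + 1 - k) [k]
    + q ^ k [n + 1 - k]] under the sum.  Absorption turns the two halves into
    [[n + 1] b] and [[n + 1] a] times the expansion of order [n] at
    [(p a, q b)], which the induction hypothesis evaluates. *)
Lemma pq_binomial (R : realType) (p q a b : R) n : 0 < q < p ->
  \sum_(0 <= k < n.+1) pq_term p q a b n k = pq_pow p q a b n.
Proof.
move=> qp; have pq : p != q by case/andP: qp => _ /gt_eqF ->.
elim: n a b => [|n IH] a b.
  by rewrite big_nat1 /pq_pow /pq_term /pq_binom /pq_fact !big_nil subnn
    !expr0 !mulr1 invr1 !mul1r.
apply: (mulfI (lt0r_neq0 (pq_int_gt0 n qp))).
rewrite pq_powS -IH mulr_sumr.
under eq_big_nat => k /andP[_ kn].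
  rewrite (pq_int_split pq (kn : (k <= n.+1)%N)) mulrDl.
  over.
rewrite big_split/= addrC.
have -> : \sum_(0 <= k < n.+2)
    p ^+ (n.+1 - k) * pq_int p q k * pq_term p q a b n.+1 k =
    pq_int p q n.+1 * b * \sum_(0 <= k < n.+1) pq_term p q (p * a) (q * b) n k.
  have := sum_pq_term_lower a b n (fun=> 1) qp.
  under eq_bigr do rewrite mul1r.
  by move=> ->; under eq_bigr do rewrite mul1r.
rewrite big_nat_recr//= subnn pq_int0 mulr0 mul0r addr0.
under eq_big_nat => k /andP[_ kn] do rewrite pq_term_absorb_upper//.
by rewrite -mulr_sumr mulrA mulrDr mulrDl.
Qed.

Lemma pq_moment1 (R : realType) (p q a b : R) n : 0 < q < p ->
  \sum_(0 <= k < n.+1) p ^+ (n - k) * pq_int p q k * pq_term p q a b n k =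
  pq_int p q n * b * pq_pow p q (p * a) (q * b) n.-1.
Proof.
move=> qp; case: n => [|n]; first by rewrite big_nat1 pq_int0 mulr0 !mul0r.
have := sum_pq_term_lower a b n (fun=> 1) qp.
under eq_bigr do rewrite mul1r.
by move=> ->; under eq_bigr do rewrite mul1r; rewrite pq_binomial.
Qed.

(** Absorb one factor [p ^ (n + 1 - k) [k]]; the remaining one, reindexed, is
    [p ^ (n - k) [k + 1] = p ^ n + q p ^ (n - k) [k]], a constant plus the
    quantity of the first moment of order [n]. *)
Lemma pq_moment2 (R : realType) (p q a b : R) n : 0 < q < p ->
  \sum_(0 <= k < n.+2)
    (p ^+ (n.+1 - k) * pq_int p q k) ^+ 2 * pq_term p q a b n.+1 k =
  pq_int p q n.+1 * b *
    (p ^+ n * pq_pow p q (p * a) (q * b) n +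
     q ^+ 2 * pq_int p q n * b *
       pq_pow p q (p ^+ 2 * a) (q ^+ 2 * b) n.-1).
Proof.
move=> qp; have pq : p != q by case/andP: qp => _ /gt_eqF ->.
under eq_bigr do rewrite expr2 -mulrA.
rewrite (sum_pq_term_lower _ _ _ (fun k => p ^+ (n.+1 - k) * pq_int p q k))//.
congr (_ * _).
have stepE k : (k < n.+1)%N -> p ^+ (n - k) * pq_int p q k.+1 =
    p ^+ n + q * (p ^+ (n - k) * pq_int p q k).
  by move=> kn; rewrite pq_intS// mulrDr -exprD subnK// mulrCA.
under eq_big_nat => k /andP[_ kn] do rewrite subSS stepE// mulrDl -(mulrA q).
rewrite big_split/= -!mulr_sumr pq_binomial// pq_moment1// !mulrA -!expr2.
by congr (_ + _); ring.
Qed.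

(** * Two inequalities for powers *)

(** Young's inequality for [u ^ s] and 1, with conjugate exponents [1 / s] and
    [1 / (1 - s)]: a concave function lies below its tangent at 1. *)
Lemma powR_le_tangent (R : realType) (u s : R) : 0 <= u -> 0 < s < 1 ->
  u `^ s <= s * u + (1 - s).
Proof.
move=> u0 /andP[s0 s1]; have s1' : 0 < 1 - s by rewrite subr_gt0.
have := @conjugate_powR R (u `^ s) 1 s^-1 (1 - s)^-1 (powR_ge0 _ _) ler01.
rewrite !invr_gt0 !invrK => /(_ s0 s1'); rewrite addrC subrK => /(_ erefl).
by rewrite mulr1 -powRrM mulfV ?gt_eqF// powRr1// powR1 mul1r mulrC.
Qed.

(** With [v] the mean, the tangent inequality is applied to the ratios
    [u i / v], whose mean is 1. *)
Lemma jensen_powR (R : realType) (I : eqType) (r : seq I) (P : pred I)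
    (w u : I -> R) (s : R) :
  (forall i, P i -> 0 <= w i) -> (forall i, P i -> 0 <= u i) ->
  \sum_(i <- r | P i) w i = 1 -> 0 < s < 1 ->
  \sum_(i <- r | P i) w i * u i `^ s <= (\sum_(i <- r | P i) w i * u i) `^ s.
Proof.
move=> w0 u0 w1 s01; have /andP[s0 s1] := s01.
set v := \sum_(i <- r | P i) w i * u i.
have : 0 <= v by apply: sumr_ge0 => i Pi; rewrite mulr_ge0 ?w0 ?u0.
rewrite le_eqVlt => /predU1P[v0|v0].
  (* A mean equal to 0 forces every w i * u i to vanish. *)
- rewrite -v0 powR0 ?gt_eqF//.
  move/eqP: v0; rewrite eq_sym psumr_eq0 => [/allP wu0|i Pi]; last first.
    by rewrite mulr_ge0 ?w0 ?u0.
  rewrite big_seq_cond big1// => i /andP[/wu0/[swap] Pi].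
  rewrite Pi/= mulf_eq0 => /orP[]/eqP->; first by rewrite mul0r.
  by rewrite powR0 ?mulr0 ?gt_eqF.
- have vs0 : 0 < v `^ s by exact: powR_gt0.
  have -> : \sum_(i <- r | P i) w i * u i `^ s =
            v `^ s * \sum_(i <- r | P i) w i * (u i / v) `^ s.
    rewrite mulr_sumr; apply: eq_bigr => i Pi.
    rewrite mulrCA -powRM ?(ltW v0)// ?divr_ge0 ?u0 ?ltW//.
    by rewrite mulrCA mulfV ?mulr1 ?gt_eqF.
  rewrite ger_pMr//.
  apply: (@le_trans _ _ (\sum_(i <- r | P i) w i * (s * (u i / v) + (1 - s)))).
    apply: ler_sum => i Pi; rewrite ler_wpM2l ?w0// powR_le_tangent//.
    by rewrite divr_ge0 ?u0 ?ltW.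
  under eq_bigr do rewrite mulrDr mulrCA (mulrA (w _)).
  rewrite big_split/= -!(mulr_suml, mulr_sumr) w1 -/v mulfV ?gt_eqF//.
  by rewrite mulr1 mul1r subrKC.
Qed.

(** The fractions [a / (a + b)] and [b / (a + b)] lie in [0, 1] and add up to 1;
    raising them to a power at most 1 can only increase them. *)
Lemma powR_addr_le (R : realType) (a b s : R) : 0 <= a -> 0 <= b ->
  0 < s <= 1 -> (a + b) `^ s <= a `^ s + b `^ s.
Proof.
move=> a0 b0 /andP[s0 s1].
have : 0 <= a + b by exact: addr_ge0.
rewrite le_eqVlt => /predU1P[<-|ab].
  by rewrite powR0 ?gt_eqF// addr_ge0// powR_ge0.
have frac c : 0 <= c <= a + b -> c / (a + b) <= (c / (a + b)) `^ s.
  move=> /andP[c0 cab]; move: c0; rewrite le_eqVlt => /predU1P[<-|c0].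
    by rewrite mul0r powR_ge0.
  by rewrite ger1_powR// divr_gt0//= ler_pdivrMr// mul1r.
have fracE c : 0 <= c -> c `^ s = (a + b) `^ s * (c / (a + b)) `^ s.
  move=> c0; rewrite -powRM ?(ltW ab)// ?divr_ge0 ?(ltW ab)//.
  by rewrite mulrCA mulfV ?mulr1 ?gt_eqF.
rewrite (fracE a)// (fracE b)// -mulrDr ler_peMr ?powR_ge0//.
apply: le_trans (lerD (frac a _) (frac b _)); last 2 first.
- by rewrite a0 lerDl.
- by rewrite b0 lerDr.
by rewrite -mulrDl mulfV ?gt_eqF.
Qed.

(** * The operator as a weighted mean *)

Definition bbh_node (R : realType) (p q : R) (n k : nat) : R :=
  p ^+ (n - k + 1) * pq_int p q k / (pq_int p q (n - k + 1) * q ^+ k).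

Definition bbh_weight (R : realType) (p q x : R) (n k : nat) : R :=
  pq_term p q 1 x n k / bbh_ell n p q x.

Lemma bbh_ellE (R : realType) n (p q x : R) :
  bbh_ell n p q x = pq_pow p q 1 x n.
Proof. by apply: eq_bigr => s _; rewrite mulr1. Qed.

Lemma bbh_ell_gt0 (R : realType) n (p q x : R) : 0 < q < p -> 0 <= x ->
  0 < bbh_ell n p q x.
Proof.
move=> /andP[q0 qp] x0; rewrite /bbh_ell; apply: prodr_gt0 => s _.
by rewrite ltr_wpDr ?exprn_gt0 ?(lt_trans q0)// mulr_ge0// exprn_ge0// ltW.
Qed.

Lemma bbh_weight_ge0 (R : realType) (p q x : R) n k : 0 < q < p -> 0 <= x ->
  0 <= bbh_weight p q x n k.
Proof.
move=> qp x0; have /andP[q0 qltp] := qp; have p0 := lt_trans q0 qltp.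
rewrite divr_ge0 ?(ltW (bbh_ell_gt0 _ _ _))// /pq_term /pq_binom.
rewrite !mulr_ge0 ?exprn_ge0 ?invr_ge0 ?mulr_ge0//; try exact: ltW.
all: by rewrite ltW// pq_fact_gt0.
Qed.

Lemma bbh_opE (R : realType) n (p q : R) (f : R -> R) x :
  bbh_op n p q f x =
  \sum_(0 <= k < n.+1) bbh_weight p q x n k * f (bbh_node p q n k).
Proof.
rewrite /bbh_op mulr_sumr; apply: eq_bigr => k _.
rewrite /bbh_weight /pq_term !bin2 -!divn2 expr1n mulr1 -/(bbh_node p q n k).
by ring.
Qed.

Lemma sum_bbh_weight (R : realType) n (p q x : R) : 0 < q < p -> 0 <= x ->
  \sum_(0 <= k < n.+1) bbh_weight p q x n k = 1.
Proof.
move=> qp x0; rewrite -mulr_suml pq_binomial// -bbh_ellE mulfV//.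
by rewrite gt_eqF// bbh_ell_gt0.
Qed.

(** * Moments of [tau] *)

(** The bounded coordinate on the half-line in which the operator becomes of
    Bernstein type and the Lipschitz-type class becomes an ordinary one. *)
Definition tau (R : realType) (t : R) : R := t / (1 + t).

Lemma bbh_node_ge0 (R : realType) (p q : R) n k : 0 < q < p ->
  0 <= bbh_node p q n k.
Proof.
move=> qp; have /andP[q0 qltp] := qp; have p0 := lt_trans q0 qltp.
have num0 := mulr_ge0 (exprn_ge0 (n - k + 1) (ltW p0)) (pq_int_ge0 k qp).
have den0 := mulr_ge0 (pq_int_ge0 (n - k + 1) qp) (exprn_ge0 k (ltW q0)).
exact: divr_ge0.
Qed.

(** The denominator [1 + t] of the node [t] becomes, by [pq_int_split], the
    single (p,q)-integer [[n + 1]], which does not depend on [k]. *)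
Lemma tau_bbh_node (R : realType) (p q : R) n k : 0 < q < p -> (k <= n)%N ->
  tau (bbh_node p q n k) =
  p / pq_int p q n.+1 * (p ^+ (n - k) * pq_int p q k).
Proof.
move=> qp kn; have /andP[q0 qltp] := qp.
have pq : p != q by rewrite gt_eqF.
have h1 := lt0r_neq0 (pq_int_gt0 (n - k) qp).
have h2 := lt0r_neq0 (pq_int_gt0 n qp).
have h3 : q ^+ k != 0 by rewrite expf_neq0// gt_eqF.
rewrite /tau /bbh_node !addn1.
move: h2; rewrite (pq_int_split pq (leqW kn)) subSn// exprS => h2.
by field; rewrite h1 h2 h3.
Qed.

Lemma bbh_tau_mean (R : realType) n (p q x : R) : 0 < q < p -> 0 <= x ->
  \sum_(0 <= k < n.+2) bbh_weight p q x n.+1 k * tau (bbh_node p q n.+1 k) =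
  p * pq_int p q n.+1 / pq_int p q n.+2 * tau x.
Proof.
move=> qp x0; have /andP[q0 qltp] := qp.
have := bbh_ell_gt0 n.+1 qp x0; rewrite bbh_ellE pq_powS => /lt0r_neq0.
rewrite mulf_eq0 negb_or => /andP[x1 P0].
have h := lt0r_neq0 (pq_int_gt0 n.+1 qp).
have M1 := pq_moment1 1 x n.+1 qp; rewrite /= in M1.
pose c := p / pq_int p q n.+2 / ((1 + x) * pq_pow p q (p * 1) (q * x) n).
rewrite (@eq_big_nat _ _ _ _ _ _ (fun k =>
  c * (p ^+ (n.+1 - k) * pq_int p q k * pq_term p q 1 x n.+1 k))) => [|k kn].
  by rewrite -mulr_sumr M1 /c /tau; field; rewrite h x1 P0.
rewrite tau_bbh_node; [|by []..].
by rewrite /bbh_weight bbh_ellE pq_powS /c; ring.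
Qed.

Lemma bbh_tau_square_mean (R : realType) n (p q x : R) :
  0 < q < p -> 0 <= x ->
  \sum_(0 <= k < n.+2)
    bbh_weight p q x n.+1 k * tau (bbh_node p q n.+1 k) ^+ 2 =
  (p / pq_int p q n.+2) ^+ 2 * pq_int p q n.+1 *
  (p ^+ n * tau x + q ^+ 2 * pq_int p q n * x ^+ 2 / ((1 + x) * (p + q * x))).
Proof.
move=> qp x0; have /andP[q0 qltp] := qp; have p0 := lt_trans q0 qltp.
have := bbh_ell_gt0 n.+1 qp x0; rewrite bbh_ellE pq_powS => /lt0r_neq0.
rewrite mulf_eq0 negb_or => /andP[x1 P0].
have h := lt0r_neq0 (pq_int_gt0 n.+1 qp).
have pqx : p + q * x != 0 by rewrite gt_eqF// ltr_wpDr// mulr_ge0// ltW.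
have M2 := pq_moment2 1 x n qp.
have E : pq_int p q n * pq_pow p q (p ^+ 2 * 1) (q ^+ 2 * x) n.-1 =
    pq_int p q n * (pq_pow p q (p * 1) (q * x) n / (p + q * x)).
  (* At n = 0 the factor [0] = 0 makes up for the truncated predecessor. *)
  case: n {h P0 M2} => [|n]; first by rewrite pq_int0 !mul0r.
  by rewrite /= pq_powS !mulr1 (mulrA q) -!expr2; field.
pose c := (p / pq_int p q n.+2) ^+ 2 /
  ((1 + x) * pq_pow p q (p * 1) (q * x) n).
rewrite (@eq_big_nat _ _ _ _ _ _ (fun k =>
  c * ((p ^+ (n.+1 - k) * pq_int p q k) ^+ 2 * pq_term p q 1 x n.+1 k)))
  => [|k kn]; last first.
  rewrite tau_bbh_node; [|by []..].
  by rewrite /bbh_weight bbh_ellE pq_powS /c; ring.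
rewrite -mulr_sumr M2 (mulrAC (q ^+ 2 * _) x) -(mulrA _ _ (pq_pow _ _ _ _ _)) E.
rewrite /c /tau.
by field; rewrite h x1 P0 pqx.
Qed.

(** The difference of the two sides is [1 - p] times a nonnegative quantity, the
    gap between the coefficients [p q ^ 2] and [p ^ 2 q ^ 2]. *)
Lemma bbh_tau_sqr_dev_le (R : realType) n (p q x : R) :
  0 < q < p -> p <= 1 -> 0 <= x ->
  \sum_(0 <= k < n.+2)
    bbh_weight p q x n.+1 k * (tau (bbh_node p q n.+1 k) - tau x) ^+ 2 <=
  bbh_delta n.+1 p q x.
Proof.
move=> qp p1 x0; have /andP[q0 qltp] := qp; have p0 := lt_trans q0 qltp.
have -> : \sum_(0 <= k < n.+2)
    bbh_weight p q x n.+1 k * (tau (bbh_node p q n.+1 k) - tau x) ^+ 2 =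
  \sum_(0 <= k < n.+2)
    bbh_weight p q x n.+1 k * tau (bbh_node p q n.+1 k) ^+ 2 -
  2 * tau x * \sum_(0 <= k < n.+2)
    bbh_weight p q x n.+1 k * tau (bbh_node p q n.+1 k) +
  tau x ^+ 2 * \sum_(0 <= k < n.+2) bbh_weight p q x n.+1 k.
  rewrite !mulr_sumr -sumrB -big_split/=; apply: eq_bigr => k _.
  by rewrite sqrrB; ring.
rewrite bbh_tau_mean// bbh_tau_square_mean// sum_bbh_weight//.
rewrite /bbh_delta addn1 subn1 /= /tau.
have x1 : 0 < 1 + x by rewrite ltr_wpDr.
have pqx : 0 < p + q * x by rewrite ltr_wpDr// mulr_ge0// ltW.
have h := pq_int_gt0 n.+1 qp.
rewrite -subr_ge0; set D := (X in 0 <= X).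
have -> : D = (1 - p) * (p * q ^+ 2 * pq_int p q n.+1 * pq_int p q n * x ^+ 2
    / (pq_int p q n.+2 ^+ 2 * ((1 + x) * (p + q * x)))).
  by rewrite /D !exprS; field; rewrite !gt_eqF.
move: (pq_int_ge0 n qp) (pq_int_ge0 n.+1 qp) h {D}.
move: (pq_int _ _ n) (pq_int _ _ n.+1) (pq_int _ _ n.+2) => i0 i1 i2 *.
rewrite mulr_ge0 ?subr_ge0// divr_ge0 ?mulr_ge0 ?exprn_ge0//.
all: exact: ltW.
Qed.

(** * The Lipschitz-type class in the coordinate [tau] *)

Lemma tau_sub_abs (R : realType) (s t : R) : 0 <= s -> 0 <= t ->
  `|tau s - tau t| = `|s - t| / ((1 + s) * (1 + t)).
Proof.
move=> s0 t0; have s1 : 0 < 1 + s by rewrite ltr_wpDr.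
have t1 : 0 < 1 + t by rewrite ltr_wpDr.
rewrite -[(1 + s) * (1 + t)]gtr0_norm ?mulr_gt0// -normf_div /tau.
by congr `|_|; field; rewrite !gt_eqF.
Qed.

Lemma tau_sub_abs_le (R : realType) (s t : R) : 0 <= s -> 0 <= t ->
  `|tau s - tau t| <= `|s - t|.
Proof.
move=> s0 t0; rewrite tau_sub_abs// ler_pdivrMr ?mulr_gt0 ?ltr_wpDr//.
by rewrite ler_peMr// mulr_ege1// lerDl.
Qed.

Lemma lip_max_class_tau (R : realType) (alpha M : R) (E : set R) (f : R -> R) :
  0 < alpha -> 0 < M -> E `<=` `[0, +oo[ -> lip_max_class alpha M E f ->
  forall x y, 0 <= x -> E y ->
    `|f x - f y| <= M * `|tau x - tau y| `^ alpha.
Proof.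
move=> a0 M0 E0 [_ _ fE] x y x0 Ey.
have y0 : 0 <= y by move: (E0 _ Ey); rewrite /= in_itv/= andbT.
have x1 : 0 < 1 + x by rewrite ltr_wpDr.
have y1 : 0 < 1 + y by rewrite ltr_wpDr.
have [<-|xy] := eqVneq x y.
  by rewrite subrr normr0 mulr_ge0 ?powR_ge0// ltW.
have d0 : 0 < `|x - y| by rewrite normr_gt0 subr_eq0.
rewrite tau_sub_abs// powRM ?invr_ge0 ?mulr_ge0 ?(ltW x1) ?(ltW y1)//.
have -> : ((1 + x) * (1 + y))^-1 `^ alpha =
          ((1 + x) `^ alpha)^-1 * ((1 + y) `^ alpha)^-1.
  rewrite -invfM -powRM ?ltW// -powRN -powR_inv1 ?mulr_ge0 ?ltW//.
  by rewrite -powRrM mulN1r.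
have X0 := powR_gt0 alpha x1; have Y0 := powR_gt0 alpha y1.
have D0 := powR_gt0 alpha d0.
have := fE x y x0 Ey xy; rewrite -ler_pdivlMl// ler_pdivrMr// => H.
by apply: le_trans H _; rewrite le_eqVlt; apply/orP; left; apply/eqP; ring.
Qed.

Lemma lip_max_class_split (R : realType) (alpha M : R) (E : set R)
    (f : R -> R) :
  0 < alpha <= 1 -> 0 < M -> E `<=` `[0, +oo[ -> lip_max_class alpha M E f ->
  forall t x y, 0 <= t -> 0 <= x -> E y ->
    `|f t - f x| <= M * (`|tau t - tau x| `^ alpha + 2 * `|x - y| `^ alpha).
Proof.
move=> a01 M0 E0 fE t x y t0 x0 Ey; have /andP[a0 _] := a01.
have y0 : 0 <= y by move: (E0 _ Ey); rewrite /= in_itv/= andbT.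
have ft := lip_max_class_tau a0 M0 E0 fE t0 Ey.
have fx := lip_max_class_tau a0 M0 E0 fE x0 Ey.
have xy : `|tau x - tau y| `^ alpha <= `|x - y| `^ alpha.
  by rewrite ge0_ler_powR ?nnegrE ?tau_sub_abs_le// ltW.
have ty : `|tau t - tau y| `^ alpha <=
          `|tau t - tau x| `^ alpha + `|tau x - tau y| `^ alpha.
  apply: le_trans (powR_addr_le _ _ a01) => //.
  rewrite ge0_ler_powR ?nnegrE ?addr_ge0 ?ler_distD//; exact: ltW.
apply: le_trans (ler_distD (f y) _ _) _; rewrite (distrC (f y)).
apply: le_trans (lerD ft fx) _; rewrite -mulrDr ler_pM2l//.
lra.
Qed.

(** An infimum passes through the increasing function [u |-> u ^ alpha]: taking
    the [1 / alpha]-th power of a positive [c] gives a lower bound of the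
    distances.  No point realizing the distance is needed, so [E] may fail to
    be closed. *)
Lemma le_dist_set_powR (R : realType) (x alpha c : R) (E : set R) :
  0 < alpha -> E !=set0 -> (forall y, E y -> c <= `|x - y| `^ alpha) ->
  c <= dist_set x E `^ alpha.
Proof.
move=> a0 [y0 Ey0] cE; have [c0|c0] := ltP 0 c; last first.
  by rewrite (le_trans c0)// powR_ge0.
have -> : c = (c `^ alpha^-1) `^ alpha.
  by rewrite -powRrM mulVf ?gt_eqF// powRr1// ltW.
have cle : c `^ alpha^-1 <= dist_set x E.
  apply: lb_le_inf; first by exists `|x - y0|, y0.
  move=> _ [y Ey <-].
  have -> : `|x - y| = (`|x - y| `^ alpha) `^ alpha^-1.
    by rewrite -powRrM mulfV ?gt_eqF// powRr1.
  by rewrite ge0_ler_powR ?nnegrE ?powR_ge0 ?cE ?invr_ge0// ltW.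
rewrite ge0_ler_powR ?nnegrE ?powR_ge0 ?(ltW a0)//.
exact: le_trans (powR_ge0 _ _) cle.
Qed.

(** * The error estimate *)

(** The estimate relative to one point [y] of [E], before the infimum is
    taken. *)
Lemma bbh_op_error_le (R : realType) n (p q alpha M x y : R) (E : set R)
    (f : R -> R) :
  0 < q < p -> p <= 1 -> 0 < alpha <= 1 -> 0 < M -> E `<=` `[0, +oo[ ->
  lip_max_class alpha M E f -> 0 <= x -> E y ->
  `|bbh_op n.+1 p q f x - f x| <=
    M * (bbh_delta n.+1 p q x `^ (alpha / 2) + 2 * `|x - y| `^ alpha).
Proof.
move=> qp p1 a01 M0 E0 fE x0 Ey; have /andP[a0 a1] := a01.
have alphaE : 2 * (alpha / 2) = alpha by field.
have W0 k := bbh_weight_ge0 n.+1 k qp x0.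
have W1 := sum_bbh_weight n.+1 qp x0.
have -> : bbh_op n.+1 p q f x - f x = \sum_(0 <= k < n.+2)
    bbh_weight p q x n.+1 k * (f (bbh_node p q n.+1 k) - f x).
  under eq_bigr do rewrite mulrBr.
  by rewrite sumrB -mulr_suml W1 mul1r bbh_opE.
apply: le_trans (ler_norm_sum _ _ _) _.
apply: (@le_trans _ _ (\sum_(0 <= k < n.+2) bbh_weight p q x n.+1 k *
  (M * (((tau (bbh_node p q n.+1 k) - tau x) ^+ 2) `^ (alpha / 2)
        + 2 * `|x - y| `^ alpha)))).
  apply: ler_sum => k _; rewrite normrM ger0_norm// ler_wpM2l//.
  rewrite -real_normK ?num_real// -powR_mulrn// -powRrM alphaE.
  by apply: (@lip_max_class_split _ _ _ E) => //; exact: bbh_node_ge0.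
under eq_bigr do rewrite mulrCA mulrDr.
rewrite -mulr_sumr big_split/= -mulr_suml W1 mul1r ler_pM2l// lerD2r.
have half : 0 < alpha / 2 < 1 by lra.
have J := @jensen_powR R nat (index_iota 0 n.+2) predT (bbh_weight p q x n.+1)
  (fun k => (tau (bbh_node p q n.+1 k) - tau x) ^+ 2) (alpha / 2)
  (fun k _ => W0 k) (fun k _ => sqr_ge0 _) W1 half.
apply: le_trans J _.
have V0 : 0 <= \sum_(0 <= k < n.+2)
    bbh_weight p q x n.+1 k * (tau (bbh_node p q n.+1 k) - tau x) ^+ 2.
  by apply: sumr_ge0 => k _; rewrite mulr_ge0 ?sqr_ge0.
have V := bbh_tau_sqr_dev_le n qp p1 x0.
rewrite ge0_ler_powR ?nnegrE ?(le_trans V0 V)//.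
by rewrite divr_ge0// ltW.
Qed.

Theorem theorem2p4 (R : realType) (p q : nat -> R)
  (hpq : forall n : nat, (1 <= n)%N -> [/\ 0 < q n, q n < p n & p n <= 1])
  (hp : p @ \oo --> (1 : R)) (hq : q @ \oo --> (1 : R))
  (alpha M : R) (halpha : 0 < alpha <= 1) (hM : 0 < M)
  (E : set R) (hE : E `<=` `[0, +oo[) (hE0 : E !=set0)
  (f : R -> R) (hf : lip_max_class alpha M E f)
  (n : nat) (hn : (1 <= n)%N) (x : R) (hx : 0 <= x) :
  `|bbh_op n (p n) (q n) f x - f x|
    <= M * (bbh_delta n (p n) (q n) x `^ (alpha / 2)
            + 2 * dist_set x E `^ alpha).
Proof.
have [q0 qltp p1] := hpq n hn; have /andP[a0 _] := halpha.
have qp : 0 < q n < p n by rewrite q0.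
case: n hn q0 qltp p1 qp => // n _ _ _ p1 qp.
set L := `|_ - _|; set D := _ `^ (alpha / 2).
rewrite -ler_pdivrMl// -lerBlDl -ler_pdivrMl//.
apply: le_dist_set_powR => // y Ey.
rewrite ler_pdivrMl// lerBlDl ler_pdivrMl//.
by apply: (@bbh_op_error_le _ _ _ _ _ _ _ _ E).
Qed.
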